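(* Let $k\in\mathbb Z_{>0}$ and $n\in\mathbb Z$ with $k\ge n$. Let $V$ be a simple $\mathfrak D^{(0,-n)}$-module of level $\ell\ne0$ such that there exists $l\in\mathbb N$ with: (a) $h_{k-\frac12}$ acts injectively on $V$; (b) $h_{i-\frac12}V=0$ and $d_jV=0$ for all $i>k$ and all $j>l$. Then the induced module $\mathrm{Ind}^{\mathfrak D}_{\mathfrak D^{(0,-n)}}(V)$ is a simple $\mathfrak D$-module if one of the following holds: (1) $k=n$, $l\ge 2n$, and $d_l$ acts injectively on $V$; (2) $k>n$, $k+n\ge 2$, and $l=n+k-1$.
   Context: $\mathfrak D$ is the Lie algebra with basis $\{d_m,h_r,\mathbf c_1,\mathbf c_2:m\in\mathbb Z,r\in\frac12+\mathbb Z\}$ and brackets $[d_m,d_n]=(m-n)d_{m+n}+\delta_{m+n,0}\frac{m^3-m}{12}\mathbf c_1$, $[d_m,h_r]=-rh_{m+r}$, $[h_r,h_s]=r\delta_{r+s,0}\mathbf c_2$, with $\mathbf c_1,\mathbf c_2$ central. For $m\in\mathbb N$, $q\in\mathbb Z$, $\mathfrak D^{(m,q)}=\bigoplus_{i\ge0}(\mathbb Cd_{m+i}\oplus\mathbb Ch_{q+i+1/2})\oplus\mathbb C\mathbf c_1\oplus\mathbb C\mathbf c_2$; so $\mathfrak D^{(0,-n)}$ is spanned by $\mathbf c_1,\mathbf c_2$, $d_i$ ($i\ge0$) and $h_{-n+i+1/2}$ ($i\ge0$). Level $\ell$ means $\mathbf c_2$ acts as $\ell$. $\mathrm{Ind}^{\mathfrak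 D}_{\mathfrak D^{(0,-n)}}(V)=U(\mathfrak D)\otimes_{U(\mathfrak D^{(0,-n)})}V$. $\mathbb N=\{0,1,2,\dots\}$. *)

(* Defs.v *)
(* The complex field is modelled as R[i] for R : realType
   (every realType is the real numbers up to isomorphism). *)
From HB Require Import structures.
From mathcomp Require Import all_boot all_order all_algebra.
From mathcomp Require Import reals.
From mathcomp Require Import complex.
Set Implicit Arguments. Unset Strict Implicit. Unset Printing Implicit Defensive.
Import Order.TTheory GRing.Theory Num.Theory.
Local Open Scope ring_scope.

Section DDefs.
Variable C : fieldType.

(* An action of the generators of D on a C-vector space M:
   dd m   acts as d_m            (m : int)
   hh z   acts as h_{z + 1/2}    (z : int), i.e. h_r with r = z + 1/2
   cc1, cc2 act as c_1, c_2.
   For a subalgebra only the generators in the subalgebra matter; the other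
   values are junk and never constrained or used. *)
Record Dact (M : lmodType C) := {
  dd : int -> {linear M -> M};
  hh : int -> {linear M -> M};
  cc1 : {linear M -> M};
  cc2 : {linear M -> M}
}.

Definition half_int (z : int) : C := z%:~R + 2%:R^-1.

(* D-module axioms (bracket relations), restricted to the generators
   d_m with Pd m and h_{z+1/2} with Ph z.  The full algebra D corresponds
   to Pd = Ph = predT; D^{(0,-n)} to Pd m := 0 <= m, Ph z := -n <= z. *)
Definition is_rep (Pd Ph : pred int) (M : lmodType C) (A : Dact M) : Prop :=
  [/\ (forall m p v, Pd m -> Pd p ->
        dd A m (dd A p v) - dd A p (dd A m v) =
        (m - p)%:~R *: dd A (m + p) v
        + (if m + p == 0 then ((m ^+ 3 - m)%:~R / 12%:R) *: cc1 A v else 0)),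
      (forall m z v, Pd m -> Ph z ->
        dd A m (hh A z v) - hh A z (dd A m v) =
        - half_int z *: hh A (m + z) v),
      (forall z w v, Ph z -> Ph w ->
        hh A z (hh A w v) - hh A w (hh A z v) =
        (if z + w + 1 == 0 then half_int z *: cc2 A v else 0)),
      (forall m v, Pd m ->
        cc1 A (dd A m v) = dd A m (cc1 A v) /\ cc2 A (dd A m v) = dd A m (cc2 A v))
    & (forall z v, Ph z ->
        cc1 A (hh A z v) = hh A z (cc1 A v) /\ cc2 A (hh A z v) = hh A z (cc2 A v))]
  /\ (forall v, cc1 A (cc2 A v) = cc2 A (cc1 A v)).

Definition is_submod (Pd Ph : pred int) (M : lmodType C) (A : Dact M)
    (S : M -> Prop) : Prop :=
  S 0 /\ (forall a u v, S u -> S v -> S (a *: u + v)) /\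
  [/\ (forall m v, Pd m -> S v -> S (dd A m v)),
      (forall z v, Ph z -> S v -> S (hh A z v)),
      (forall v, S v -> S (cc1 A v)) & (forall v, S v -> S (cc2 A v))].

Definition is_simple (Pd Ph : pred int) (M : lmodType C) (A : Dact M) : Prop :=
  is_rep Pd Ph A /\ (exists v : M, v != 0) /\
  forall S, is_submod Pd Ph A S -> (forall v, S v -> v = 0) \/ (forall v, S v).

Definition is_hom (Pd Ph : pred int) (M N : lmodType C) (A : Dact M) (B : Dact N)
    (f : {linear M -> N}) : Prop :=
  [/\ (forall m v, Pd m -> f (dd A m v) = dd B m (f v)),
      (forall z v, Ph z -> f (hh A z v) = hh B z (f v)),
      (forall v, f (cc1 A v) = cc1 B (f v)) & (forall v, f (cc2 A v) = cc2 B (f v))].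

Definition Pd0 : pred int := fun m => 0 <= m.
Definition Phn (n : int) : pred int := fun z => - n <= z.

(* (W, A, iota) is Ind_{D^{(0,-n)}}^{D}(V) = U(D) (x)_{U(D^{(0,-n)})} V,
   characterized by its defining universal property: iota : V -> W is a
   D^{(0,-n)}-module map, and every D^{(0,-n)}-module map from V into a
   D-module extends uniquely (through iota) to a D-module map. *)
Definition is_induced (n : int) (V : lmodType C) (AV : Dact V)
    (W : lmodType C) (AW : Dact W) (iota : {linear V -> W}) : Prop :=
  is_rep predT predT AW /\ is_hom Pd0 (Phn n) AV AW iota /\
  forall (N : lmodType C) (AN : Dact N) (f : {linear V -> N}),
    is_rep predT predT AN -> is_hom Pd0 (Phn n) AV AN f ->
    (exists g : {linear W -> N}, is_hom predT predT AW AN g /\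
                                 forall v, g (iota v) = f v) /\
    (forall g1 g2 : {linear W -> N},
       is_hom predT predT AW AN g1 -> is_hom predT predT AW AN g2 ->
       (forall v, g1 (iota v) = f v) -> (forall v, g2 (iota v) = f v) ->
       forall w, g1 w = g2 w).

End DDefs.

(* Main.v *)
Require Import Defs.
From HB Require Import structures.
From mathcomp Require Import all_boot all_order all_algebra.
From mathcomp Require Import reals boolp functions.
From mathcomp Require Import complex.
From mathcomp Require Import zify ring.
Set Implicit Arguments. Unset Strict Implicit. Unset Printing Implicit Defensive.
Import Order.TTheory GRing.Theory Num.Theory.
Local Open Scope ring_scope.

(* Filter W = Ind V by the weight of words in the letters d_{-i} and h_{-n-i+1/2} of
   weight i >= 1. To each letter z of weight i corresponds an element p of
   D^(0,-n) that kills V and lowers the filtration by at least i: for d_{-i} and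
   h_{-n-i+1/2} these are d_{l+i} and h_{n+i-1/2} in case (1), h_{k+i-1/2} and
   d_{l+i} in case (2). Its bracket with z is a non-zero multiple of d_l, c_2 or
   h_{k-1/2}, which acts injectively on V. On the symbol of a vector whose words
   only involve z and later letters, p acts as a non-zero multiple of the derivative
   with respect to z composed with that injective operator. Hence for a vector of
   positive weight some p has a non-zero symbol, so that any non-zero submodule
   contains a non-zero vector of iota V; since V is simple and generates W, the
   submodule is W.

   This needs neither a basis of W nor the PBW theorem, only iota <> 0, that is, a
   non-zero map from V to some D-module. If the generators outside the subalgebra b
   acting on V span a subalgebra n, then V embeds in the module of functions from the
   enveloping algebra to V, by sending v to the component of w v along
   Ind V = V + n Ind V. For n < 0 this is applied twice, through D^(0,0). *)

Lemma eq_from_sub0 (V : zmodType) (a b : V) : 0 + (a - b) = 0 -> a = b.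
Proof. by rewrite add0r => /eqP; rewrite subr_eq0 => /eqP. Qed.

(* Decides identities of abelian groups: everything is moved to the left-hand side, and
   each pair of opposite terms is bubbled to the end of the sum and cancelled. *)
Ltac zcancel x :=
  do 16?rewrite [_ + x + _]addrAC; do 16?rewrite [_ - x + _]addrAC; rewrite (addrK x).
Ltac zmod :=
  rewrite ?(oppr0, addr0, add0r);
  apply: eq_from_sub0; rewrite ?(opprD, opprK) ?addrA;
  repeat match goal with |- context [- ?x] => zcancel x end; try done.

Inductive gen := Dg of int | Hg of int | C1g | C2g.

(** * The bracket of the mirror Heisenberg-Virasoro algebra *)

Section Evaluation.
Variables (C : fieldType) (G : Type) (M : lmodType C).
Implicit Types (F : G -> M) (s : seq (C * G)).

(** A bracket is kept as a list of coefficients and generators. As [F] is arbitrary, one identity of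
    [ev] values serves both actions on a module and functions of words. *)
Definition ev F s : M := \sum_(p <- s) p.1 *: F p.2.

Lemma ev_nil F : ev F [::] = 0. Proof. by rewrite /ev big_nil. Qed.
Lemma ev_cons F a g s : ev F ((a, g) :: s) = a *: F g + ev F s.
Proof. by rewrite /ev big_cons. Qed.

Lemma ev_ext F1 F2 s : (forall g, F1 g = F2 g) -> ev F1 s = ev F2 s.
Proof. by move=> e; apply: eq_bigr => p _; rewrite e. Qed.

Lemma ev0 s : ev (fun=> 0) s = 0.
Proof. by rewrite /ev big1 // => p _; rewrite scaler0. Qed.

Lemma evD F1 F2 s : ev (fun g => F1 g + F2 g) s = ev F1 s + ev F2 s.
Proof. by rewrite /ev -big_split; apply: eq_bigr => p _; rewrite scalerDr. Qed.

Lemma evZ a F s : ev (fun g => a *: F g) s = a *: ev F s.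
Proof.
by rewrite /ev scaler_sumr; apply: eq_bigr => p _; rewrite !scalerA mulrC.
Qed.

Lemma evB F1 F2 s : ev (fun g => F1 g - F2 g) s = ev F1 s - ev F2 s.
Proof.
by rewrite -scaleN1r -evZ -evD; apply: ev_ext => g; rewrite scaleN1r.
Qed.

Lemma ev_lin (N : lmodType C) (f : {linear M -> N}) F s :
  f (ev F s) = \sum_(p <- s) p.1 *: f (F p.2).
Proof. by rewrite /ev linear_sum; apply: eq_bigr => p _; rewrite linearZ. Qed.

Lemma ev_all (P : G -> bool) F1 F2 s :
  all (fun p => P p.2) s -> (forall g, P g -> F1 g = F2 g) -> ev F1 s = ev F2 s.
Proof.
move=> + e; elim: s => [|[a g] s IH] /=; first by rewrite !ev_nil.
by case/andP=> Pg /IH; rewrite !ev_cons => ->; rewrite e.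
Qed.

End Evaluation.

Lemma ev_exch (C : fieldType) (G : Type) (M : lmodType C)
    (F : G -> G -> M) (s r : seq (C * G)) :
  ev (fun g => ev (F g) r) s = ev (fun h => ev (F^~ h) s) r.
Proof.
elim: s => [|[a g] s IH].
  rewrite ev_nil -[LHS](ev0 M r); apply: ev_ext => h.
  by rewrite ev_nil.
rewrite ev_cons IH -evZ -evD; apply: ev_ext => h.
by rewrite ev_cons.
Qed.

Lemma ev_if (C : fieldType) (G : Type) (M : lmodType C) (F : G -> M) (b : bool) a g :
  ev F (if b then [:: (a, g)] else [::]) = (if b then a else 0) *: F g.
Proof. by case: b; rewrite ?ev_cons ev_nil ?addr0 ?scale0r. Qed.

Section Bracket.
Variable C : numFieldType.

Definition br (x y : gen) : seq (C * gen) :=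
  match x, y with
  | Dg m, Dg p => ((m - p)%:~R, Dg (m + p)) ::
      (if m + p == 0 then [:: ((m ^+ 3 - m)%:~R / 12%:R, C1g)] else [::])
  | Dg m, Hg z => [:: (- half_int C z, Hg (m + z))]
  | Hg z, Dg m => [:: (half_int C z, Hg (m + z))]
  | Hg z, Hg w => if z + w + 1 == 0 then [:: (half_int C z, C2g)] else [::]
  | _, _ => [::]
  end.

Lemma half_int_neq0 z : half_int C z != 0.
Proof.
have -> : half_int C z = (2 * z + 1)%:~R / 2%:R.
  by rewrite /half_int rmorphD rmorphM /=; field.
by rewrite mulf_neq0 // ?invr_eq0 ?pnatr_eq0 // intr_eq0; lia.
Qed.

Lemma half_int_opp z w : z + w + 1 = 0 -> half_int C w = - half_int C z.
Proof.
move=> e; have -> : w = - z - 1 by lia.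
by rewrite /half_int rmorphB rmorphN /=; field.
Qed.

Section Identities.
Variables (M : lmodType C) (F : gen -> M).

Lemma br_antisym x y : ev F (br y x) = - ev F (br x y).
Proof.
case: x y => [m|z||] [p|w||] //=; rewrite ?ev_nil ?oppr0 //.
- rewrite !ev_cons opprD -scaleNr (addrC p m) -rmorphN opprB; congr (_ + _).
  case: eqP => e; last by rewrite ev_nil oppr0.
  rewrite !ev_cons !ev_nil !addr0 -scaleNr; congr (_ *: _).
  have -> : p = - m by lia.
  by rewrite !rmorphB !rmorphXn /= !rmorphN /=; ring.
- by rewrite !ev_cons !ev_nil !addr0 scaleNr opprK.
- by rewrite !ev_cons !ev_nil !addr0 scaleNr.
- rewrite (addrC w z); case: eqP => e; last by rewrite ev_nil oppr0.
  by rewrite !ev_cons !ev_nil !addr0 -scaleNr (half_int_opp e).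
Qed.

(** The Jacobi identity is put in the form that ad z is a derivation, as [deriv] uses it. *)
Lemma br_jacobi z x y :
  ev (fun g => ev F (br z g)) (br x y) =
  ev (fun g => ev F (br g y)) (br z x) + ev (fun g => ev F (br x g)) (br z y).
Proof.
case: z x y => [m|a||] [p|b||] [q|c||] //=;
  rewrite ?(ev_cons, ev_if, ev_nil) /= ?(ev_cons, ev_if, ev_nil) ?(scaler0, addr0) //.
all: try by rewrite -[LHS]addr0.
- rewrite (_ : m + p + q = m + (p + q)); last by lia.
  rewrite (_ : p + (m + q) = m + (p + q)); last by lia.
  rewrite !scalerDr !scalerA addrACA -!scalerDl.
  congr (_ *: _ + _ *: _); first by rewrite !(rmorphB, rmorphD) /=; ring.
  case: eqP => e; last by rewrite !mulr0 addr0.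
  have -> : m = - p - q by lia.
  by rewrite !(rmorphB, rmorphD, rmorphN, rmorphXn) /=; ring.
- rewrite (_ : m + p + c = m + (p + c)); last by lia.
  rewrite (_ : p + (m + c) = m + (p + c)); last by lia.
  rewrite !scalerA -scalerDl; congr (_ *: _).
  by rewrite /half_int !(rmorphB, rmorphD) /=; ring.
- rewrite (_ : m + q + b = m + (q + b)); last by lia.
  rewrite (_ : q + (m + b) = m + (q + b)); last by lia.
  rewrite !scalerA -scalerDl; congr (_ *: _).
  by rewrite /half_int !(rmorphB, rmorphD) /=; ring.
- rewrite (_ : b + (m + c) = m + b + c); last by lia.
  rewrite !scalerA -scalerDl; case: eqP => e; last by rewrite !mulr0 addr0 scale0r.
  rewrite (half_int_opp e) (_ : _ + _ = 0) ?scale0r //.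
  by ring.
- rewrite (_ : p + q + a = p + (q + a)); last by lia.
  rewrite (_ : q + (p + a) = p + (q + a)); last by lia.
  rewrite !scalerA -scalerDl; congr (_ *: _).
  by rewrite /half_int !(rmorphB, rmorphD) /=; ring.
- rewrite (_ : p + a + c = a + (p + c)); last by lia.
  rewrite !scalerA; case: eqP => e; last by rewrite !mulr0.
  rewrite (_ : c = - (p + a) - 1); last by lia.
  by congr (_ *: _); rewrite /half_int !(rmorphB, rmorphD, rmorphN) /=; field.
- rewrite (_ : b + (q + a) = a + (q + b)); last by lia.
  rewrite add0r !scalerA; case: eqP => e; last by rewrite !mulr0.
  by rewrite mulrC.
Qed.
End Identities.
End Bracket.

(** * Modules, submodules and homomorphisms, uniformly in the generators *)

Section Actions.
Variable C : numFieldType.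

Definition act (M : lmodType C) (A : Dact M) (g : gen) : {linear M -> M} :=
  match g with Dg m => dd A m | Hg z => hh A z | C1g => cc1 A | C2g => cc2 A end.

Definition actD (M : lmodType C) (f : gen -> {linear M -> M}) : Dact M :=
  {| dd := fun m => f (Dg m); hh := fun z => f (Hg z);
     cc1 := f C1g; cc2 := f C2g |}.

Lemma act_actD (M : lmodType C) (f : gen -> {linear M -> M}) g :
  act (actD f) g = f g.
Proof. by case: g. Qed.

Definition spans (Pd Ph : pred int) (g : gen) : bool :=
  match g with Dg m => Pd m | Hg z => Ph z | _ => true end.

Lemma is_repP (Pd Ph : pred int) (M : lmodType C) (A : Dact M) :
  is_rep Pd Ph A <->
  forall x y v, spans Pd Ph x -> spans Pd Ph y ->
    act A x (act A y v) - act A y (act A x v) = ev (fun g => act A g v) (br C x y).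
Proof.
split.
  case=> -[rdd rdh rhh rcd rch] rcc [m|z||] [p|w||] v //= Px Py;
    rewrite ?(ev_cons, ev_if, ev_nil) ?addr0 //=.
  - by rewrite rdd //; case: eqP => //; rewrite scale0r.
  - exact: rdh.
  - by rewrite (proj1 (rcd m v Px)) subrr.
  - by rewrite (proj2 (rcd m v Px)) subrr.
  - by rewrite -opprB rdh // -scaleNr opprK.
  - by rewrite rhh //; case: eqP => //; rewrite scale0r.
  - by rewrite (proj1 (rch z v Px)) subrr.
  - by rewrite (proj2 (rch z v Px)) subrr.
  - by rewrite (proj1 (rcd p v Py)) subrr.
  - by rewrite (proj1 (rch w v Py)) subrr.
  - by rewrite subrr.
  - by rewrite rcc subrr.
  - by rewrite (proj2 (rcd p v Py)) subrr.
  - by rewrite (proj2 (rch w v Py)) subrr.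
  - by rewrite rcc subrr.
  - by rewrite subrr.
move=> r; split; [split|].
- move=> m p v Pm Pp; move: (r (Dg m) (Dg p) v Pm Pp) => /= ->.
  by rewrite ev_cons ev_if; case: eqP => //; rewrite scale0r.
- move=> m z v Pm Pz; move: (r (Dg m) (Hg z) v Pm Pz) => /= ->.
  by rewrite ev_cons ev_nil addr0.
- move=> z w v Pz Pw; move: (r (Hg z) (Hg w) v Pz Pw) => /= ->.
  by rewrite ev_if; case: eqP => //; rewrite scale0r.
- move=> m v Pm; split; apply/eqP; rewrite -subr_eq0.
    by move: (r C1g (Dg m) v isT Pm) => /= ->; rewrite ev_nil.
  by move: (r C2g (Dg m) v isT Pm) => /= ->; rewrite ev_nil.
- move=> z v Pz; split; apply/eqP; rewrite -subr_eq0.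
    by move: (r C1g (Hg z) v isT Pz) => /= ->; rewrite ev_nil.
  by move: (r C2g (Hg z) v isT Pz) => /= ->; rewrite ev_nil.
- move=> v; apply/eqP; rewrite -subr_eq0.
  by move: (r C1g C2g v isT isT) => /= ->; rewrite ev_nil.
Qed.

Lemma is_submodP (Pd Ph : pred int) (M : lmodType C) (A : Dact M) (S : M -> Prop) :
  is_submod Pd Ph A S <->
  [/\ S 0, forall a u v, S u -> S v -> S (a *: u + v) &
      forall x v, spans Pd Ph x -> S v -> S (act A x v)].
Proof.
split=> [[S0 [Sl [Sd Sh S1 S2]]]|[S0 Sl Sa]].
  split=> // -[m|z||] v /= Px Sv; [exact: Sd|exact: Sh|exact: S1|exact: S2].
split=> //; split=> //; split.
- by move=> m v; apply: (Sa (Dg m)).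
- by move=> z v; apply: (Sa (Hg z)).
- by move=> v; apply: (Sa C1g).
- by move=> v; apply: (Sa C2g).
Qed.

Lemma is_homP (Pd Ph : pred int) (M N : lmodType C) (A : Dact M) (B : Dact N)
    (f : {linear M -> N}) :
  is_hom Pd Ph A B f <->
  forall x v, spans Pd Ph x -> f (act A x v) = act B x (f v).
Proof.
split=> [[fd fh f1 f2] [m|z||] v /= Px|fa].
- exact: fd.
- exact: fh.
- exact: f1.
- exact: f2.
split.
- by move=> m v; apply: (fa (Dg m)).
- by move=> z v; apply: (fa (Hg z)).
- by move=> v; apply: (fa C1g).
- by move=> v; apply: (fa C2g).
Qed.
End Actions.

(** * Subspaces as vector spaces *)

Section Subspace.
Variables (C : numFieldType) (M : lmodType C) (P : M -> Prop).
Hypotheses (P0 : P 0) (Plin : forall a u v, P u -> P v -> P (a *: u + v)).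

(** The closure proofs are arguments, so that the submodule structure can be inferred from the term
    itself. *)
Definition in_subspace
  (_ : P 0) (_ : forall a u v, P u -> P v -> P (a *: u + v)) : {pred M} :=
  fun x => `[< P x >].
Local Notation S := (in_subspace P0 Plin).

Lemma in_subspaceP x : reflect (P x) (x \in S).
Proof. exact: asboolP. Qed.

Lemma subspace_closed : submod_closed S.
Proof.
split; first exact/in_subspaceP.
by move=> a u v /in_subspaceP Pu /in_subspaceP Pv; apply/in_subspaceP/Plin.
Qed.
HB.instance Definition _ := GRing.isSubmodClosed.Build C M S subspace_closed.

Record subspace := Subspace { subspace_val : M; subspace_valP : subspace_val \in S }.
HB.instance Definition _ := [isSub for subspace_val].
HB.instance Definition _ := [Choice of subspace by <:].
HB.instance Definition _ := [SubChoice_isSubLmodule of subspace by <:].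
End Subspace.

Section SubspaceMaps.
Variables (C : numFieldType) (M : lmodType C) (P : M -> Prop).
Hypotheses (P0 : P 0) (Plin : forall a u v, P u -> P v -> P (a *: u + v)).
Local Notation T := (subspace P0 Plin).

Lemma subspace_prop (x : T) : P (val x).
Proof. exact/(in_subspaceP P0 Plin)/(valP x). Qed.

Definition into_subspace (N : lmodType C) (f : {linear N -> M})
  (Pf : forall x, P (f x)) (x : N) : T :=
  Subspace (introT (in_subspaceP P0 Plin (f x)) (Pf x)).

Lemma into_subspace_linear (N : lmodType C) (f : {linear N -> M}) Pf :
  linear (@into_subspace N f Pf).
Proof. by move=> a x y; apply: val_inj; rewrite /= linearP. Qed.
HB.instance Definition _ (N : lmodType C) (f : {linear N -> M}) Pf :=
  GRing.isLinear.Build _ _ _ _ (@into_subspace N f Pf)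
    (@into_subspace_linear N f Pf).
End SubspaceMaps.

(** * Embedding a module of a subalgebra into a module of the algebra *)

Section Derivation.
Variables (C : numFieldType) (V : lmodType C).
Local Notation br := (br C).
Implicit Types (F : seq gen -> V) (u w : seq gen).

(* [deriv b F] is the derivative of [F], viewed as a multilinear function of the
   letters of a word, along the adjoint action of [b]. *)
Fixpoint deriv (b : gen) F w : V :=
  if w is y :: w' then
    ev (fun g => F (g :: w')) (br b y) + deriv b (fun w'' => F (y :: w'')) w'
  else 0.

Lemma derivS b F y w :
  deriv b F (y :: w) =
  ev (fun g => F (g :: w)) (br b y) + deriv b (fun w' => F (y :: w')) w.
Proof. by []. Qed.

Lemma deriv_ext b F1 F2 w :
  (forall w', size w' = size w -> F1 w' = F2 w') -> deriv b F1 w = deriv b F2 w.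
Proof.
elim: w F1 F2 => [|y w IH] F1 F2 e //=; congr (_ + _).
  by apply: ev_ext => g; apply: e.
by apply: IH => w' sw; apply: e; rewrite /= sw.
Qed.

Lemma derivD b F1 F2 w :
  deriv b (fun w => F1 w + F2 w) w = deriv b F1 w + deriv b F2 w.
Proof.
elim: w F1 F2 => [|y w IH] F1 F2 /=; first by rewrite addr0.
by rewrite evD IH addrACA.
Qed.

Lemma derivZ b a F w : deriv b (fun w => a *: F w) w = a *: deriv b F w.
Proof.
elim: w F => [|y w IH] F /=; first by rewrite scaler0.
by rewrite evZ IH scalerDr.
Qed.

Lemma derivB b F1 F2 w :
  deriv b (fun w => F1 w - F2 w) w = deriv b F1 w - deriv b F2 w.
Proof.
rewrite -scaleN1r -derivZ -derivD; apply: deriv_ext => w' _.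
by rewrite scaleN1r.
Qed.

Lemma deriv0 b w : deriv b (fun=> 0) w = 0.
Proof. by elim: w => //= y w ->; rewrite ev0 addr0. Qed.

Lemma deriv_ev b (F : gen -> seq gen -> V) s w :
  deriv b (fun w => ev (F^~ w) s) w = ev (fun g => deriv b (F g) w) s.
Proof.
elim: w F => [|y w IH] F /=; first by rewrite ev0.
by rewrite evD IH ev_exch.
Qed.

Lemma deriv_cat b F u w :
  deriv b F (u ++ w) =
  deriv b (fun u' => F (u' ++ w)) u + deriv b (fun w' => F (u ++ w')) w.
Proof.
by elim: u F => [|y u IH] F /=; rewrite ?add0r // IH addrA.
Qed.

(** The adjoint action on words is a representation; passing to functions of words reverses the
    order, hence [br e c]. By induction, the terms where [c] and [e] hit different letters cancel,
    and on the first letter the identity is Jacobi. *)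
Lemma deriv_comm c e F w :
  deriv c (deriv e F) w - deriv e (deriv c F) w =
  ev (fun g => deriv g F w) (br e c).
Proof.
elim: w F => [|y w IH] F /=; first by rewrite subrr ev0.
rewrite [RHS]evD -(IH (fun w' => F (y :: w'))) !derivD !deriv_ev !evD.
rewrite br_jacobi.
set a1 := ev (fun g => ev _ (br g y)) _; set a2 := ev _ (br e y).
set a3 := ev _ (br c y); set a4 := ev _ (br e y).
set a5 := deriv c _ w; set a6 := deriv e _ w.
by zmod.
Qed.


End Derivation.

Section Extension.
Variables (C : numFieldType) (Pd Ph Ld Lh : pred int).
Variables (V : lmodType C) (A : Dact V).
Local Notation br := (br C).
Local Notation Pb := (spans Pd Ph).
Local Notation PL := (spans Ld Lh).
Hypothesis A_rep : is_rep Pd Ph A.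
Hypothesis sub_closed : forall x y, Pb x -> Pb y -> all (fun p => Pb p.2) (br x y).
Hypothesis full_closed : forall x y, PL x -> PL y -> all (fun p => PL p.2) (br x y).
Hypothesis sub_full : forall x, Pb x -> PL x.
Hypothesis compl_closed : forall x y, PL x -> PL y -> ~~ Pb x -> ~~ Pb y ->
  all (fun p => ~~ Pb p.2) (br x y).

(* [proj (size w) w v] is the component in [V] of [w v] along Ind V = V + n Ind V,
   where n is spanned by the generators outside [Pb]: it vanishes if the leftmost letter
   of [w] is in n, and a leftmost letter in [Pb] is moved to the right until it acts on
   [v]. *)
Fixpoint proj (n : nat) (w : seq gen) (v : V) : V :=
  match n, w with
  | n'.+1, x :: w' =>
      if Pb x then proj n' w' (act A x v) + deriv x (proj n' ^~ v) w' else 0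
  | _, _ => v
  end.

Lemma projS n x w v : proj n.+1 (x :: w) v =
  if Pb x then proj n w (act A x v) + deriv x (proj n ^~ v) w else 0.
Proof. by []. Qed.

Lemma proj_linear n w : linear (proj n w).
Proof.
elim: n w => [|n IH] [|x w] // a u v /=.
case: ifP => _; last by rewrite scaler0 addr0.
rewrite linearP IH scalerDr -derivZ addrACA -derivD; congr (_ + _).
by apply: deriv_ext => w' _; rewrite IH.
Qed.
HB.instance Definition _ n w :=
  GRing.isLinear.Build _ _ _ _ (proj n w) (proj_linear n w).

Lemma proj_ev n w s v :
  proj n w (ev (fun g => act A g v) s) = ev (fun g => proj n w (act A g v)) s.
Proof. exact: ev_lin. Qed.

(** If both letters are in the subalgebra, the difference is the module axiom on [v] plus
    [deriv_comm]. If only one is, its derivation hitting the other gives the bracket, and all other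
    terms vanish. If neither is, both sides vanish because the complement is closed. *)
Lemma proj_rel_head m w x y v : PL x -> PL y ->
  proj m.+2 (x :: y :: w) v - proj m.+2 (y :: x :: w) v =
  ev (fun g => proj m.+1 (g :: w) v) (br x y).
Proof.
move=> Lx Ly; have rep := iffLR (is_repP _ _ _) A_rep.
set T := RHS; rewrite (projS m.+1 x) (projS m.+1 y) !derivS -/T.
have -> : ev (fun g => proj m.+1 (g :: w) v) (br y x) = - T.
  exact: br_antisym.
have out z : ~~ Pb z -> forall g v', proj m.+1 (z :: w) v' = 0 /\
    deriv g (fun w' => proj m.+1 (z :: w') v) w = 0.
  move=> Pz g v'; rewrite projS (negbTE Pz); split=> //.
  by rewrite -[RHS](deriv0 V g w); apply: deriv_ext => w' _; rewrite projS (negbTE Pz).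
have inn z : Pb z -> forall g, deriv g (fun w' => proj m.+1 (z :: w') v) w =
    deriv g (proj m ^~ (act A z v)) w + deriv g (deriv z (proj m ^~ v)) w.
  by move=> Pz g; rewrite -derivD; apply: deriv_ext => w' _; rewrite projS Pz.
case Px: (Pb x); case Py: (Pb y).
- have : - T = ev (fun g => proj m w (act A g v) + deriv g (proj m ^~ v) w) (br y x).
    rewrite -[- T]br_antisym.
    by apply: (ev_all (sub_closed Py Px)) => g; rewrite projS => ->.
  rewrite evD -proj_ev -rep // linearB -deriv_comm => /(canRL (@opprK _)) e.
  rewrite !inn // !projS Px Py; move: T e => T /= ->; clear.
  by zmod.
- by case: (out y (negbT Py) x (act A x v)) => -> ->; zmod.
- by case: (out x (negbT Px) y (act A y v)) => -> ->; zmod.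
- rewrite subrr -[LHS](ev0 V (br x y)).
  apply: (ev_all (P := fun g => ~~ Pb g)) => [|g /negbTE Pg]; last by rewrite projS Pg.
  by apply: compl_closed; rewrite ?Px ?Py.
Qed.

(** A first letter [z] in the subalgebra moves right. Where it acts on [v], on [u] or on [w],
    induction applies; where it hits [x] or [y], induction with [z,x] or [z,y] as a letter gives, by
    Jacobi, the derivative of [x,y]. *)
Lemma proj_rel m u w x y v : (size u + size w)%N = m -> PL x -> PL y ->
  proj m.+2 (u ++ x :: y :: w) v - proj m.+2 (u ++ y :: x :: w) v =
  ev (fun g => proj m.+1 (u ++ g :: w) v) (br x y).
Proof.
elim: m u w x y v => [|m IH] [|z u] w x y v // sz Lx Ly;
  [exact: proj_rel_head|exact: proj_rel_head|].
rewrite [LHS]/=; case Pz: (Pb z); last first.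
  by rewrite subrr /= Pz ev0.
have Lz := sub_full Pz.
have {}sz : (size u + size w)%N = m by case: sz.
have -> : ev (fun g => proj m.+2 ((z :: u) ++ g :: w) v) (br x y) =
    ev (fun g => proj m.+1 (u ++ g :: w) (act A z v)) (br x y) +
    ev (fun g => deriv z (proj m.+1 ^~ v) (u ++ g :: w)) (br x y).
  by rewrite -evD; apply: ev_ext => g; rewrite cat_cons projS Pz.
rewrite -IH //.
rewrite (ev_ext (F2 := fun g => deriv z (fun u' => proj m.+1 (u' ++ g :: w) v) u +
  (ev (fun h => proj m.+1 (u ++ h :: w) v) (br z g) +
   deriv z (fun w' => proj m.+1 (u ++ g :: w') v) w))); last first.
  by move=> g; rewrite deriv_cat derivS.
rewrite !evD br_jacobi -!deriv_ev.
rewrite (@deriv_ext _ _ z _ (fun u' => proj m.+2 (u' ++ x :: y :: w) v -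
   proj m.+2 (u' ++ y :: x :: w) v) u); last first.
  by move=> u' su; rewrite IH // su.
rewrite (@deriv_ext _ _ z _ (fun w' => proj m.+2 (u ++ x :: y :: w') v -
   proj m.+2 (u ++ y :: x :: w') v) w); last first.
  by move=> w' sw; rewrite IH // sw.
rewrite -(ev_all (full_closed Lz Lx)
  (F1 := fun g => proj m.+2 (u ++ g :: y :: w) v - proj m.+2 (u ++ y :: g :: w) v));
  last by move=> g Lg; apply: IH.
rewrite -(ev_all (full_closed Lz Ly)
  (F1 := fun g => proj m.+2 (u ++ x :: g :: w) v - proj m.+2 (u ++ g :: x :: w) v));
  last by move=> g Lg; apply: IH.
rewrite !derivB !evB !deriv_cat !derivS.
by zmod.
Qed.

(** This makes [proj_word] equivariant. When a leading [x] passes the final [b], the term [x,b] v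
    turns b x v into x b v. *)
Lemma proj_rcons n w b v : size w = n -> Pb b ->
  proj n.+1 (rcons w b) v = proj n w (act A b v).
Proof.
have rep := iffLR (is_repP _ _ _) A_rep.
elim: n w b v => [|n IH] [|x w] b v //.
  by move=> _ Pb_b; rewrite /rcons projS Pb_b addr0.
case=> sz Pb_b; rewrite rcons_cons !projS; case Px: (Pb x) => //.
rewrite IH // -cats1 deriv_cat derivS.
rewrite (@deriv_ext _ _ x _ (proj n ^~ (act A b v))); last first.
  by move=> w' sw; rewrite cats1 IH // sw.
rewrite (ev_all (sub_closed Px Pb_b) (F2 := fun g => proj n w (act A g v)));
  last by move=> g Pg; rewrite cats1 IH.
rewrite -proj_ev -rep // linearB /=.
by zmod.
Qed.

(** These functions of words respect xy - yx = [x,y], so on letters in [PL] they are the linear maps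
    from the enveloping algebra to [V]. *)
Definition word_rel (F : seq gen -> V) : Prop :=
  forall u w x y, PL x -> PL y ->
    F (u ++ x :: y :: w) - F (u ++ y :: x :: w) =
    ev (fun g => F (u ++ g :: w)) (br x y).

Lemma word_rel0 : word_rel 0.
Proof. by move=> u w x y _ _; rewrite subrr ev0. Qed.

Lemma word_rel_lin a F1 F2 : word_rel F1 -> word_rel F2 -> word_rel (a *: F1 + F2).
Proof.
move=> r1 r2 u w x y Lx Ly.
rewrite evD evZ -r1 // -r2 // scalerBr.
have E u' : (a *: F1 + F2) u' = a *: F1 u' + F2 u' by [].
by rewrite !E; zmod.
Qed.

Local Notation N := (subspace word_rel0 word_rel_lin).

(** Appending on the right gives a left action: (x (y F))(w) = F(w x y). *)
Definition translate (x : gen) (F : seq gen -> V) : seq gen -> V :=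
  fun w => F (rcons w x).

Lemma translate_linear x : linear (translate x).
Proof. by []. Qed.
HB.instance Definition _ x :=
  GRing.isLinear.Build _ _ _ _ (translate x) (translate_linear x).

Lemma translate_rel x F : word_rel F -> word_rel (translate x F).
Proof.
move=> r u w y z Ly Lz; rewrite /translate !rcons_cat !rcons_cons r //.
by apply: ev_ext => g; rewrite rcons_cat.
Qed.

Definition ext_act (x : gen) : {linear N -> N} :=
  into_subspace word_rel0 word_rel_lin (f := translate x \o val)
    (fun F => translate_rel x (subspace_prop F)).

Lemma ev_val (F : gen -> N) s w :
  val (ev F s) w = ev (fun g => val (F g) w) s.
Proof.
elim: s => [|[a g] s IH]; first by rewrite !ev_nil.
by rewrite !ev_cons -IH linearP.
Qed.

Lemma ext_rep : is_rep Ld Lh (actD ext_act).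
Proof.
apply/is_repP => x y F Lx Ly.
apply: val_inj; apply/funext => w.
rewrite ev_val linearB /= !act_actD /=.
have := subspace_prop F; move/(_ w [::] x y Lx Ly).
rewrite -!cat_rcons !cats0 => e.
rewrite -[LHS]/(translate x (translate y (val F)) w - translate y (translate x (val F)) w).
rewrite /translate e; apply: ev_ext => g.
by rewrite act_actD cats1.
Qed.

Definition proj_word (v : V) : seq gen -> V := fun w => proj (size w) w v.

Lemma proj_word_linear : linear proj_word.
Proof. by move=> a u v; apply/funext => w; rewrite /proj_word linearP. Qed.
HB.instance Definition _ :=
  GRing.isLinear.Build _ _ _ _ proj_word proj_word_linear.

Lemma proj_word_rel v : word_rel (proj_word v).
Proof.
move=> u w x y Lx Ly.
rewrite /proj_word !size_cat /= !addnS proj_rel //.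
by apply: ev_ext => g; rewrite size_cat /= addnS.
Qed.

Lemma module_extension : exists (M : lmodType C) (B : Dact M) (f : {linear V -> M}),
  [/\ is_rep Ld Lh B, is_hom Pd Ph A B f & injective f].
Proof.
exists N, (actD ext_act).
exists (into_subspace word_rel0 word_rel_lin (f := proj_word) proj_word_rel).
split; first exact: ext_rep.
  apply/is_homP => x v Px; apply: val_inj; apply/funext => w.
  by rewrite act_actD /= /translate /proj_word size_rcons proj_rcons.
(* The value at the empty word recovers the vector. *)
by move=> u v /(congr1 val) /(congr1 (fun F => F [::])).
Qed.

End Extension.

(** * Generation and injectivity of the induced module *)

Section Induced.
Variables (C : numFieldType) (n : int).
Variables (V : lmodType C) (AV : Dact V) (W : lmodType C) (AW : Dact W).
Variable iota : {linear V -> W}.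
Hypothesis W_ind : is_induced n AV AW iota.

(** The universal property gives a map from [W] to the module [S]. Followed by the inclusion, it
    agrees with the identity on the image of [iota], so it is the identity by uniqueness. *)
Lemma induced_generated (S : W -> Prop) : is_submod predT predT AW S ->
  (forall v, S (iota v)) -> forall w, S w.
Proof.
move=> /is_submodP[S0 Slin Sact] Siota w.
have [W_rep [iota_hom univ]] := W_ind.
have Sval g (x : subspace S0 Slin) : S ((act AW g \o val) x).
  by apply: Sact; [case: g|apply: subspace_prop].
pose BS := actD (fun g => into_subspace S0 Slin (f := act AW g \o val) (Sval g)
  : {linear _ -> _}).
pose iotaS : {linear V -> _} := into_subspace S0 Slin (f := iota) Siota.
have BS_val g x : val (act BS g x) = act AW g (val x) by rewrite act_actD.
have BS_rep : is_rep predT predT BS.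
  apply/is_repP => x y v Px Py; apply: val_inj.
  rewrite linearB /= !BS_val (iffLR (is_repP _ _ _) W_rep) //.
  rewrite [RHS](ev_lin val); apply: eq_bigr => c _.
  by congr (_ *: _); rewrite -BS_val.
have iotaS_hom : is_hom Pd0 (Phn n) AV BS iotaS.
  apply/is_homP => x v Px; apply: val_inj.
  by rewrite BS_val /= (iffLR (is_homP _ _ _ _ _) iota_hom).
have [[g [g_hom g_iota]] _] := univ _ BS iotaS BS_rep iotaS_hom.
have [_ uniq] := univ _ AW iota W_rep iota_hom.
have -> : w = (val \o g) w.
  apply: (uniq idfun) => //.
    apply/is_homP => x v _ /=.
    by rewrite (iffLR (is_homP _ _ _ _ _) g_hom) ?BS_val //; case: x.
  by move=> v /=; rewrite g_iota.
exact: subspace_prop.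
Qed.

Lemma full_span g : spans predT predT g. Proof. by case: g. Qed.

(** For n >= 0 the complement of D^(0,-n) is closed, as two of its h's have indices too negative for
    a central term. For n < 0 such a term can occur, so D^(0,0) is interposed: the h's between the
    two subalgebras commute. *)
Lemma embeds_in_full_module : is_rep Pd0 (Phn n) AV ->
  exists (M : lmodType C) (B : Dact M) (f : {linear V -> M}),
  [/\ is_rep predT predT B, is_hom Pd0 (Phn n) AV B f & injective f].
Proof.
move=> V_rep.
have clD m0 x y : spans Pd0 (Phn m0) x -> spans Pd0 (Phn m0) y ->
    all (fun p => spans Pd0 (Phn m0) p.2) (br C x y).
  case: x y => [m|z||] [p|w||] //=; rewrite /Pd0 /Phn => ? ?.
  - by apply/andP; split; [lia|case: ifP].
  - by rewrite andbT; lia.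
  - by rewrite andbT; lia.
  - by case: ifP.
have clT x y : spans predT predT x -> spans predT predT y ->
    all (fun p => spans predT predT p.2) (br C x y).
  by move=> _ _; elim: (br C x y) => //= c s ->; rewrite full_span.
have clC m0 x y : 0 <= m0 -> spans predT predT x -> spans predT predT y ->
    ~~ spans Pd0 (Phn m0) x -> ~~ spans Pd0 (Phn m0) y ->
    all (fun p => ~~ spans Pd0 (Phn m0) p.2) (br C x y).
  move=> m0_ge0 _ _; case: x y => [m|z||] [p|w||] //=; rewrite /Pd0 /Phn => ? ?.
  - by apply/andP; split; [lia|case: eqP => //; lia].
  - by rewrite andbT; lia.
  - by rewrite andbT; lia.
  - by case: eqP => //; lia.
have [n_ge0|n_lt0] := leP 0 n.
  by apply: module_extension => // *; [apply: clD|exact: full_span|apply: clC].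
have [M1 [B1 [f1 [rep1 hom1 inj1]]]] : exists (M : lmodType C) (B : Dact M)
    (f : {linear V -> M}),
    [/\ is_rep Pd0 (Phn 0) B, is_hom Pd0 (Phn n) AV B f & injective f].
  apply: module_extension => //; [exact: clD|exact: clD| |].
    by case=> //= z; rewrite /Phn; lia.
  move=> x y Lx Ly nPx nPy.
  case: x Lx nPx => [m /= ->|z Lz _|//|//] //.
  case: y Ly nPy => [m /= ->|w Lw _|//|//] //.
  by move: Lz Lw; rewrite /= /Phn; case: eqP => //; lia.
have [M2 [B2 [f2 [rep2 hom2 inj2]]]] : exists (M : lmodType C) (B : Dact M)
    (f : {linear M1 -> M}),
    [/\ is_rep predT predT B, is_hom Pd0 (Phn 0) B1 B f & injective f].
  by apply: module_extension => // *; [apply: clD|exact: full_span|apply: clC].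
exists M2, B2, (f2 \o f1); split=> //; last exact: inj_comp.
apply/is_homP => x v Px /=.
rewrite (iffLR (is_homP _ _ _ _ _) hom1) // (iffLR (is_homP _ _ _ _ _) hom2) //.
by case: x Px => //= z; rewrite /Phn; lia.
Qed.

(** The kernel is a submodule of the simple [V]. Were it all of [V], every map from [V] to a
    D-module would factor through 0, contrary to the embedding. *)
Lemma induced_injective : is_simple Pd0 (Phn n) AV -> injective iota.
Proof.
case=> V_rep [[v0 v0_neq0] simple].
have [_ [iota_hom univ]] := W_ind.
suff ker v : iota v = 0 -> v = 0.
  move=> u v e; apply/eqP; rewrite -subr_eq0; apply/eqP/ker.
  by rewrite linearB e subrr.
move: v; case: (simple (fun v => iota v = 0)) => // [|all0].
  apply/is_submodP; split=> [|a u v u0 v0'|x v Px v0'].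
  - exact: linear0.
  - by rewrite linearP u0 v0' scaler0 addr0.
  - by rewrite (iffLR (is_homP _ _ _ _ _) iota_hom) // v0' linear0.
have [M [B [f [M_rep f_hom f_inj]]]] := embeds_in_full_module V_rep.
have [[g [_ g_iota]] _] := univ M B f M_rep f_hom.
case/eqP: v0_neq0; apply: f_inj.
by rewrite -g_iota all0 !linear0.
Qed.
End Induced.

(** * The weight filtration *)

Lemma int_strong_ind (P : int -> Prop) :
  (forall q, q < 0 -> P q) ->
  (forall q, 0 <= q -> (forall q', q' < q -> P q') -> P q) -> forall q, P q.
Proof.
move=> Pneg Pind; suff H (n : nat) : forall q : int, q < n%:Z -> P q.
  by move=> q; apply: (H (`|q|%N).+1); lia.
elim: n => [|n IH] q qn; first exact: Pneg.
have [q0|q0] := ltP q 0; first exact: Pneg.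
by apply: Pind => // q' q'q; apply: IH; lia.
Qed.

Section Filtration.
Variables (C : numFieldType) (V W : lmodType C) (A : Dact W) (iota : {linear V -> W}).
Local Notation br := (br C).
Local Notation "g $ u" := (act A g u) (at level 35, right associativity).
(** [z t] are the letters, [p t] is the lowering element paired with [z t], and [p t, z t] is [cf t]
    times the injective operator [al t]. *)
Variables (deg : gen -> int) (z p al : nat -> gen) (cf : nat -> C).
Local Notation wt t := (deg (z t)).

(** The span of the words of weight at most [q] applied to the image of [iota], with the letters in
    any order. *)
Inductive fil : int -> W -> Prop :=
| fil0 q : fil q 0
| fil_iota q v : 0 <= q -> fil q (iota v)
| fil_lin q a u v : fil q u -> fil q v -> fil q (a *: u + v)
| fil_z q t u : fil (q - wt t) u -> fil q (z t $ u).

(* Modulo [fil (q - 1)], the span of the words of weight [q] in the letters [z s],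
   [s >= t]. *)
Inductive efil (t : nat) : int -> W -> Prop :=
| efil_low q u : fil (q - 1) u -> efil t q u
| efil_iota v : efil t 0 (iota v)
| efil_lin q a u v : efil t q u -> efil t q v -> efil t q (a *: u + v)
| efil_z q s u : (t <= s)%N -> efil t (q - wt s) u -> efil t q (z s $ u).

Hypothesis A_rep : is_rep predT predT A.
Hypothesis wt_gt0 : forall t, 0 < wt t.
Hypothesis wt_unbounded : forall q, exists T, forall t, (T <= t)%N -> q < wt t.
Hypothesis act_iota : forall g v, fil (deg g) (g $ iota v).
Hypothesis deg_br : forall g t, all (fun c => deg c.2 <= deg g + wt t) (br g (z t)).
Hypothesis br_zz : forall s t, (t < s)%N ->
  [\/ br (z s) (z t) = [::],
      exists c r, [/\ br (z s) (z t) = [:: (c, z r)], (t < r)%N & wt r = wt s + wt t]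
    | exists c g, br (z s) (z t) = [:: (c, g)] /\ deg g < wt s + wt t].
Hypothesis deg_p : forall t, deg (p t) = - wt t.
Hypothesis deg_al : forall t, deg (al t) = 0.
Hypothesis al_iota : forall t v, exists v', al t $ iota v = iota v'.
Hypothesis al_inj : forall t v, al t $ iota v = 0 -> v = 0.
Hypothesis br_pz : forall s t, (t < s)%N ->
  all (fun c => deg c.2 < wt s - wt t) (br (p t) (z s)).
Hypothesis br_pz_eq : forall t, br (p t) (z t) = [:: (cf t, al t)].
Hypothesis cf_neq0 : forall t, cf t != 0.
Hypothesis br_alz : forall s t, all (fun c => deg c.2 < wt s) (br (al t) (z s)).
Hypothesis br_pal : forall s t, all (fun c => deg c.2 < - wt s) (br (p s) (al t)).

Lemma act_comm x y u : x $ y $ u = y $ x $ u + ev (fun g => g $ u) (br x y).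
Proof.
by rewrite -(iffLR (is_repP _ _ _) A_rep) ?subrKC //; [case: x|case: y].
Qed.

Lemma p_z t u : p t $ z t $ u = z t $ p t $ u + cf t *: (al t $ u).
Proof. by rewrite act_comm br_pz_eq ev_cons ev_nil addr0. Qed.

Lemma filD q u v : fil q u -> fil q v -> fil q (u + v).
Proof. by move=> fu; rewrite -[u]scale1r; apply: fil_lin. Qed.

Lemma filZ q a u : fil q u -> fil q (a *: u).
Proof. by move=> fu; rewrite -[_ *: _]addr0; apply: fil_lin => //; apply: fil0. Qed.

Lemma filB q u v : fil q u -> fil q v -> fil q (u - v).
Proof. by move=> fu fv; apply: filD => //; rewrite -scaleN1r; apply: filZ. Qed.

Lemma fil_addl q u v : fil q u -> fil q (u + v) -> fil q v.
Proof. by move=> fu fuv; rewrite -[v](addKr u) addrC; apply: filB. Qed.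

Lemma fil_addr q u v : fil q v -> fil q (u + v) -> fil q u.
Proof. by rewrite addrC; apply: fil_addl. Qed.

Lemma fil_mono q q' u : fil q u -> q <= q' -> fil q' u.
Proof.
move=> fu; elim: fu q' => {q u} => [q|q v q0|q a u v _ IHu _ IHv|q t u _ IH] q' le.
- exact: fil0.
- by apply: fil_iota; lia.
- by apply: fil_lin; [apply: IHu|apply: IHv].
- by apply: fil_z; apply: IH; lia.
Qed.

Lemma fil_neg q u : fil q u -> q < 0 -> u = 0.
Proof.
elim=> {q u} // [q v q0|q a u v _ IHu _ IHv|q t u _ IH] neg.
- by lia.
- by rewrite IHu // IHv // scaler0 addr0.
- by rewrite IH ?linear0 //; have := wt_gt0 t; lia.
Qed.

Lemma fil_ev q d u s : (forall g, fil (q + deg g) (g $ u)) ->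
  all (fun c => deg c.2 <= d) s -> fil (q + d) (ev (fun g => g $ u) s).
Proof.
move=> fu; elim: s => [|[a g] s IH] /=; first by rewrite ev_nil; constructor.
case/andP=> dg /IH fs; rewrite ev_cons; apply: fil_lin => //.
by apply: (fil_mono (fu g)); lia.
Qed.

(** Moving [g] past the letters of a word costs brackets, whose degrees [deg_br] controls, until [g]
    reaches the image of [iota]. *)
Lemma fil_act q u : fil q u -> forall g, fil (q + deg g) (g $ u).
Proof.
elim=> {q u} => [q|q v q0|q a u v _ IHu _ IHv|q t u fu IH] g.
- by rewrite linear0; apply: fil0.
- by apply: (fil_mono (act_iota g v)); lia.
- by rewrite linearP; apply: fil_lin.
- rewrite act_comm; apply: filD.
    by apply: fil_z; apply: (fil_mono (IH g)); lia.
  by apply: (fil_mono (fil_ev IH (deg_br g t))); lia.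
Qed.

Lemma fil_br q d x y u : fil q u -> all (fun c => deg c.2 < d) (br x y) ->
  fil (q + d - 1) (ev (fun g => g $ u) (br x y)).
Proof.
move=> fu lt; rewrite -addrA; apply: fil_ev; first exact: fil_act.
by apply: sub_all lt => c /=; lia.
Qed.

Lemma fil_p q t u : fil q u -> fil (q - wt t) (p t $ u).
Proof. by move=> fu; rewrite -deg_p; apply: fil_act. Qed.

Lemma fil_al q t u : fil q u -> fil q (al t $ u).
Proof. by move=> fu; have := fil_act fu (al t); rewrite deg_al addr0. Qed.

Lemma fil_zD q t u : fil q u -> fil (q + wt t) (z t $ u).
Proof. by move=> fu; apply: fil_act. Qed.

Lemma efilD t q u v : efil t q u -> efil t q v -> efil t q (u + v).
Proof. by move=> fu; rewrite -[u]scale1r; apply: efil_lin. Qed.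

Lemma efil0 t q : efil t q 0. Proof. by apply: efil_low; apply: fil0. Qed.

Lemma efilZ t q a u : efil t q u -> efil t q (a *: u).
Proof. by move=> fu; rewrite -[_ *: _]addr0; apply: efil_lin => //; apply: efil0. Qed.

Lemma efil_fil t q u : efil t q u -> fil q u.
Proof.
elim=> {q u} [q u fu|v|q a u v _ fu _ fv|q s u _ _ fu].
- by apply: (fil_mono fu); lia.
- exact: fil_iota.
- exact: fil_lin.
- exact: fil_z.
Qed.

Lemma fil_efil0 q u : fil q u -> efil 0 q u.
Proof.
elim=> {q u} [q|q v q0|q a u v _ fu _ fv|q t u _ fu].
- exact: efil0.
- have [->|q1] := eqVneq q 0; first exact: efil_iota.
  by apply: efil_low; apply: fil_iota; lia.
- exact: efil_lin.
- exact: efil_z.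
Qed.

(** A word of weight exactly q > 0 contains a letter, and here every available letter is heavier
    than [q]. *)
Lemma efil_large t q u : 0 < q -> (forall s, (t <= s)%N -> q < wt s) ->
  efil t q u -> fil (q - 1) u.
Proof.
move=> q0 big fu; elim: fu q0 big => {q u} //
  [q a u v _ fu _ fv|q s u ts fu _] q0 big.
- by apply: fil_lin; [apply: fu|apply: fv].
- rewrite (fil_neg (efil_fil fu)) ?linear0; first exact: fil0.
  by have := big s ts; lia.
Qed.

Lemma fil_zero_iota q u : fil q u -> q = 0 -> exists v, u = iota v.
Proof.
elim=> {q u} [q|q v _|q a u v _ IHu _ IHv|q t u fu _] e.
- by exists 0; rewrite linear0.
- by exists v.
- have [u' ->] := IHu e; have [v' ->] := IHv e.
  by exists (a *: u' + v'); rewrite linearP.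
- exists 0; rewrite (fil_neg fu) ?linear0 //; have := wt_gt0 t; lia.
Qed.

Lemma efil_al s t q u : efil t q u -> efil t q (al s $ u).
Proof.
elim=> {q u} [q u fu|v|q a u v _ fu _ fv|q r u tr efu fu].
- by apply: efil_low; apply: fil_al.
- by have [v' ->] := al_iota s v; apply: efil_iota.
- by rewrite linearP; apply: efil_lin.
- rewrite act_comm; apply: efilD; first exact: efil_z.
  by apply: efil_low; apply: (fil_mono (fil_br (efil_fil efu) (br_alz r s))); lia.
Qed.

(** The derivative with respect to [z t] of a symbol in later letters is 0: [p t] commutes with them
    modulo lower weight and kills the image of [iota]. *)
Lemma efil_p_lower t q u : efil t.+1 q u -> fil (q - wt t - 1) (p t $ u).
Proof.
elim=> {q u} [q u fu|v|q a u v _ fu _ fv|q r u tr efu fu].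
- by apply: (fil_mono (fil_p t fu)); lia.
- rewrite (fil_neg (act_iota (p t) v)); first exact: fil0.
  by rewrite deg_p; have := wt_gt0 t; lia.
- by rewrite linearP; apply: fil_lin.
- rewrite act_comm; apply: filD; first by apply: fil_z; apply: (fil_mono fu); lia.
  by apply: (fil_mono (fil_br (efil_fil efu) (br_pz tr))); lia.
Qed.

(** Division of a symbol by [z t], with a remainder in the later letters. *)
Definition peeled t q u := exists g e,
  [/\ efil t (q - wt t) g, efil t.+1 q e & u = z t $ g + e].

Lemma peeled_lin t q a u v : peeled t q u -> peeled t q v -> peeled t q (a *: u + v).
Proof.
case=> [g [e [fg fe ->]]] [g' [e' [fg' fe' ->]]].
exists (a *: g + g'), (a *: e + e'); split; [exact: efil_lin|exact: efil_lin|].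
by rewrite linearP scalerDr; zmod.
Qed.

Lemma peeled_low t q u : efil t.+1 q u -> peeled t q u.
Proof. by move=> fu; exists 0, u; rewrite linear0 add0r; split=> //; apply: efil0. Qed.

Lemma efil_peeled t q : (forall q', q' < q -> forall s u, (t < s)%N ->
    efil t q' u -> peeled t (q' + wt s) (z s $ u)) ->
  forall u, efil t q u -> peeled t q u.
Proof.
move=> + u fu; elim: fu => {q u} [q u fu|v|q a u v _ IHu _ IHv|q s u ts fu _] H.
- by apply: peeled_low; apply: efil_low.
- by apply: peeled_low; apply: efil_iota.
- by apply: peeled_lin; [apply: IHu|apply: IHv].
- move: ts; rewrite leq_eqVlt => /predU1P[ts|ts].
    by exists u, 0; rewrite -ts addr0 in fu *; split=> //; apply: efil0.
  have := wt_gt0 s => ws.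
  have -> : q = q - wt s + wt s by lia.
  by apply: H => //; lia.
Qed.

(** Moving [z s] past [z t] leaves their bracket. By [br_zz] it is 0, of lower degree, or a multiple
    of a letter after [z t]; the last acts on the quotient, whose weight is smaller, so induction
    applies. *)
Lemma z_peeled t q : forall s u, (t < s)%N -> efil t q u -> peeled t (q + wt s) (z s $ u).
Proof.
elim/int_strong_ind: q => [q q0|q q0 IH] s u ts fu.
  rewrite (fil_neg (efil_fil fu)) // linear0.
  by apply: peeled_low; apply: efil0.
have [g [e [fg fe ->]]] := efil_peeled IH fu.
rewrite linearD act_comm.
have pzz : peeled t (q + wt s) (z t $ z s $ g).
  exists (z s $ g), 0; rewrite addr0; split=> //; last exact: efil0.
  apply: efil_z; first exact: ltnW.
  by have -> : q + wt s - wt t - wt s = q - wt t by lia.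
have pze : peeled t (q + wt s) (z s $ e).
  by apply/peeled_low/efil_z => //; have -> : q + wt s - wt s = q by lia.
have padd u1 u2 : peeled t (q + wt s) u1 -> peeled t (q + wt s) u2 ->
    peeled t (q + wt s) (u1 + u2).
  by move=> p1; rewrite -[u1]scale1r; apply: peeled_lin.
apply: (padd) => //; apply: (padd) => //.
have wt0 := wt_gt0 t.
case: (br_zz ts) => [->|[c [r [-> tr wr]]]|[c [g' [-> dg']]]].
- by rewrite ev_nil; apply/peeled_low/efil0.
- rewrite ev_cons ev_nil; apply: peeled_lin; last exact/peeled_low/efil0.
  have -> : q + wt s = q - wt t + wt r by lia.
  by apply: IH => //; lia.
- rewrite ev_cons ev_nil; apply: peeled_lin; last exact/peeled_low/efil0.
  apply/peeled_low/efil_low.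
  by apply: (fil_mono (fil_act (efil_fil fg) g')); lia.
Qed.

Lemma peel t q u : efil t q u -> peeled t q u.
Proof. by apply: efil_peeled => q' _ s u'; apply: z_peeled. Qed.

Lemma efil_p t q : forall u, efil t q u -> efil t (q - wt t) (p t $ u).
Proof.
elim/int_strong_ind: q => [q q0|q q0 IH] u fu.
  by rewrite (fil_neg (efil_fil fu)) // linear0; apply: efil0.
have [g [e [fg fe ->]]] := peel fu.
have wt0 := wt_gt0 t.
rewrite linearD p_z; apply: efilD; last by apply/efil_low/efil_p_lower.
apply: efilD; last by apply/efilZ/efil_al.
by apply: efil_z => //; apply: IH => //; lia.
Qed.

Section InductionStep.
Variable q : int.

(* The three statements proved together: some [p t] is non-zero on a given symbol,
   every [al t] is injective on symbols, and so is [c cf al + z p] for [c > 0], which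
   acts on [z^a e] with [e] in [efil t.+1] as [(c + a) cf al]. *)
Definition p_detects := forall w, fil q w -> ~ fil (q - 1) w -> 0 < q ->
  exists t, ~ fil (q - wt t - 1) (p t $ w).
Definition al_injective := forall t w, fil q w -> fil (q - 1) (al t $ w) ->
  fil (q - 1) w.
Definition euler_injective := forall t c g, efil t q g ->
  fil (q - 1) ((c.+1%:R * cf t) *: (al t $ g) + z t $ p t $ g) -> fil (q - 1) g.

Hypothesis q_ge0 : 0 <= q.
Hypothesis al_IH : forall t w, fil (q - wt t) w -> forall s,
  fil (q - wt t - 1) (al s $ w) -> fil (q - wt t - 1) w.
Hypothesis euler_IH : forall t c g, efil t (q - wt t) g ->
  fil (q - wt t - 1) ((c.+1%:R * cf t) *: (al t $ g) + z t $ p t $ g) ->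
  fil (q - wt t - 1) g.

Lemma p_detects_step : p_detects.
Proof.
move=> w fw nfw q0.
(* [z t] is the first letter that occurs in the symbol of [w]; it exists because the weights are
   unbounded. *)
have [t fwt nfwt] : exists2 t, efil t q w & ~ efil t.+1 q w.
  apply: contrapT => nex.
  have all_t t : efil t q w.
    elim: t => [|t IH]; first exact: fil_efil0.
    by apply: contrapT => nft; apply: nex; exists t.
  by have [T big] := wt_unbounded q; apply/nfw/(efil_large q0 big)/all_t.
exists t => fpw; apply: nfwt.
have [g [e [fg fe we]]] := peel fwt.
rewrite we; apply: efilD => //; apply: efil_low.
have wt0 := wt_gt0 t.
have -> : q - 1 = q - wt t - 1 + wt t by lia.
(* p z g = cf al g + z p g is the Euler operator with c = 0. *)
apply: fil_zD; apply: (euler_IH (c := 0)) => //.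
apply: (fil_addr (efil_p_lower fe)); move: fpw.
by rewrite we linearD p_z mul1r (addrC (cf t *: _)).
Qed.

(** On symbols [al s] commutes with [p t]. If it killed the symbol of [w], it would kill that of p t
    w, which is non-zero for some [t] and of smaller weight. *)
Lemma al_injective_step : al_injective.
Proof.
move=> s w fw faw.
have [q0|q0] := eqVneq q 0.
  have [v wv] := fil_zero_iota fw q0; rewrite wv.
  have e : al s $ iota v = 0.
    by rewrite -wv; apply: (fil_neg faw); rewrite q0.
  by rewrite (al_inj e) linear0; apply: fil0.
apply: contrapT => nfw.
have [|t] := p_detects_step fw nfw; first by lia.
apply; apply: (al_IH _ (s := s)); first exact: fil_p.
have fpaw : fil (q - wt t - 1) (p t $ al s $ w).
  by apply: (fil_mono (fil_p t faw)); lia.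
by move: fpaw; rewrite act_comm; apply: fil_addr; apply: fil_br.
Qed.

(** With g = z g1 + e1, the hypothesis says that z h + (c+1) cf al e1 is low. Applying [p t] gives p
    z h low, so [h] is low by the case c = 0, then [g1] by the case c+1, and finally [e1] by
    injectivity of [al t]. *)
Lemma euler_injective_step : euler_injective.
Proof.
move=> t c g fg.
have wt0 := wt_gt0 t.
have eq1 : q - 1 = q - wt t - 1 + wt t by lia.
have [g1 [e1 [fg1 fe1 ->]]] := peel fg.
(* One more [cf t] times [al t] comes from commuting [p t] past [z t], whence c+2. *)
set h := (c.+2%:R * cf t) *: (al t $ g1) + z t $ p t $ g1.
set low := (c.+1%:R * cf t) *: ev (fun x => x $ g1) (br (al t) (z t)) + z t $ p t $ e1.
have fh : efil t (q - wt t) h.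
  apply: efil_lin; first exact: efil_al.
  by apply: efil_z => //; apply: efil_p.
have flow : fil (q - 1) low.
  apply: fil_lin.
    by apply: (fil_mono (fil_br (efil_fil fg1) (br_alz t t))); lia.
  by rewrite eq1; apply: fil_zD; apply: efil_p_lower.
have -> : (c.+1%:R * cf t) *: (al t $ (z t $ g1 + e1)) + z t $ p t $ (z t $ g1 + e1)
    = low + (z t $ h + (c.+1%:R * cf t) *: (al t $ e1)).
  rewrite /h /low -(natr1 c.+1) mulrDl mul1r scalerDl.
  rewrite !linearD p_z [al t $ z t $ g1]act_comm !linearD !linearZ /=.
  by zmod.
move=> /(fil_addl flow) fzh.
have fe' : efil t.+1 q ((c.+1%:R * cf t) *: (al t $ e1)) by apply/efilZ/efil_al.
have fh' : fil (q - wt t - 1) h.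
  apply: (euler_IH (c := 0)) => //.
  apply: (fil_addr (efil_p_lower fe')).
  have := fil_p t fzh; rewrite linearD p_z mul1r (addrC (cf t *: _)).
  by have -> : q - 1 - wt t = q - wt t - 1 by lia.
have fg1' : fil (q - wt t - 1) g1 by apply: (euler_IH (c := c.+1)).
have fz u : fil (q - wt t - 1) u -> fil (q - 1) (z t $ u).
  by rewrite eq1; apply: fil_zD.
apply: filD; first exact: fz.
apply: (al_injective_step (t := t)); first exact: efil_fil fe1.
have := filZ (c.+1%:R * cf t)^-1 (fil_addl (fz _ fh') fzh).
by rewrite scalerK // mulf_neq0 // pnatr_eq0.
Qed.
End InductionStep.

Lemma symbols_injective q : [/\ p_detects q, al_injective q & euler_injective q].
Proof.
elim/int_strong_ind: q => [q q0|q q0 IH].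
  have f0 w : fil q w -> fil (q - 1) w by move=> /fil_neg -> //; apply: fil0.
  by split=> [w /f0 //|t w /f0|t c g /efil_fil /f0].
have lt t : q - wt t < q by have := wt_gt0 t; lia.
have al_IH t w (fw : fil (q - wt t) w) s := (let: And3 _ H _ := IH _ (lt t) in H s w fw).
have eu_IH t c g := (let: And3 _ _ H := IH _ (lt t) in H t c g).
split; [exact: p_detects_step|exact: al_injective_step|exact: euler_injective_step].
Qed.

(** Starting from [w], suitable [p t] lower the weight while keeping the vector non-zero, until
    weight 0 is reached. *)
Lemma p_stable_meets_iota (S : W -> Prop) : (forall t w, S w -> S (p t $ w)) ->
  forall q w, fil q w -> S w -> w != 0 -> exists2 v, v != 0 & S (iota v).
Proof.
move=> Sp; elim/int_strong_ind => [q q0|q q0 IH] w fw Sw w0.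
  by rewrite (fil_neg fw) ?eqxx in w0.
have [fw'|nfw] := pselect (fil (q - 1) w).
  by apply: (IH (q - 1)) fw' _ _ => //; lia.
have [e|qn0] := eqVneq q 0.
  have [v wv] := fil_zero_iota fw e; exists v; last by rewrite -wv.
  by apply: contra_neq w0 => v0; rewrite wv v0 linear0.
have [det _ _] := symbols_injective q.
have [|t npw] := det w fw nfw; first by lia.
apply: (IH (q - wt t)) (fil_p t fw) (Sp t w Sw) _.
  by have := wt_gt0 t; lia.
by apply/eqP => pw0; apply: npw; rewrite pw0; apply: fil0.
Qed.

End Filtration.

(* The letters are d_{-1}, h_{-n-1/2}, d_{-2}, h_{-n-3/2}, ...; [idx t] is the weight
   of the [t]-th one. *)
Definition idx (t : nat) : int := (t./2.+1)%:Z.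

Lemma idx_gt0 t : 0 < idx t. Proof. by []. Qed.

(** The two booleans are the parities of [s] and [t]: at equal weight the d letter (even) precedes
    the h letter (odd). *)
Variant letter_lt_spec s t : bool -> bool -> Prop :=
| LetterLt b b' of idx t < idx s : letter_lt_spec s t b b'
| LetterEq of idx t = idx s : letter_lt_spec s t true false.

Lemma letter_ltP s t : (t < s)%N -> letter_lt_spec s t (odd s) (odd t).
Proof.
move=> ts; have := odd_double_half s; have := odd_double_half t; rewrite -!muln2.
move=> et es.
have [lt|le] := ltP (idx t) (idx s); first exact: LetterLt.
move: le; rewrite /idx; move: et es.
case: (odd s); case: (odd t) => /= et es le; try by lia.
by apply: LetterEq; rewrite /idx; lia.
Qed.

Lemma letter_index b (i : int) : 0 < i -> exists2 r, odd r = b & idx r = i.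
Proof.
move=> i0; exists (b + (`|i|%N.-1).*2)%N.
  by rewrite oddD odd_double addbF; case: b.
by rewrite /idx half_bit_double; lia.
Qed.

Lemma letter_idx_lt r t : idx t < idx r -> (t < r)%N.
Proof.
by rewrite ltnNge /idx => lt; apply/negP => /half_leq; lia.
Qed.

(** * Degrees of the generators and brackets of the letters *)

Section Degrees.
Variables (C : numFieldType) (k : nat) (n : int) (l : nat).
Local Notation br := (br C).
Hypotheses (kn : 2 <= k%:Z + n) (l_gt0 : (0 < l)%N).

(* [deg g] bounds the shift of the filtration under [g]. *)
Definition degD (s : int) : int := Num.max (- s) (Num.min 0 (l%:Z - s)).
Definition degH (z : int) : int := Num.max (- n - z) (Num.min 0 (k%:Z - 1 - z)).
Definition deg (g : gen) : int :=
  match g with Dg s => degD s | Hg z => degH z | _ => 0 end.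

Definition letter (t : nat) : gen := if odd t then Hg (- n - idx t) else Dg (- idx t).

Lemma deg_letter t : deg (letter t) = idx t.
Proof.
by have := idx_gt0 t; rewrite /letter; case: odd => /=; rewrite /degD /degH; lia.
Qed.

Lemma letter_unbounded q : exists T, forall t, (T <= t)%N -> q < deg (letter t).
Proof.
exists (`|q|%N).*2 => t; rewrite deg_letter /idx => /half_leq; rewrite doubleK; lia.
Qed.

Lemma br_letters s t : (t < s)%N ->
  [\/ br (letter s) (letter t) = [::],
      exists c r, [/\ br (letter s) (letter t) = [:: (c, letter r)], (t < r)%N &
                      deg (letter r) = deg (letter s) + deg (letter t)]
    | exists c g, br (letter s) (letter t) = [:: (c, g)] /\
                  deg g < deg (letter s) + deg (letter t)].
Proof.
move=> ts; rewrite !deg_letter.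
have := idx_gt0 s; have := idx_gt0 t => t0 s0.
have sum b c : (if b then Hg (- n - (idx s + idx t)) else Dg (- (idx s + idx t))) = c ->
    exists r, [/\ letter r = c, (t < r)%N & deg (letter r) = idx s + idx t].
  move=> <-; have [|r rb ri] := @letter_index b (idx s + idx t); first by lia.
  exists r; rewrite deg_letter ri; split=> //; first by rewrite /letter rb ri.
  by apply: letter_idx_lt; lia.
move eB: (br (letter s) (letter t)) => B; move: eB; rewrite {1 2}/letter.
case: (odd s); case: (odd t); rewrite /br => <-.
- case: eqP => e; [constructor 3|by constructor 1].
  by exists (half_int C (- n - idx s)), C2g; split=> //; rewrite /deg; lia.
- constructor 2; have [|r [<- tr dr]] := sum true (Hg (- idx t + (- n - idx s))).
    by congr Hg; lia.
  by exists (half_int C (- n - idx s)), r.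
- constructor 2; have [|r [<- tr dr]] := sum true (Hg (- idx s + (- n - idx t))).
    by congr Hg; lia.
  by exists (- half_int C (- n - idx t)), r.
- have -> : (- idx s + - idx t == 0) = false by apply/eqP; lia.
  constructor 2; have [|r [<- tr dr]] := sum false (Dg (- idx s + - idx t)).
    by congr Dg; lia.
  by exists ((- idx s - - idx t)%:~R), r.
Qed.

(** The two assumptions cover the brackets of d and of h with an h letter, where the relation
    between k, n and l enters. *)
Lemma deg_br_letter g t :
  (forall s : int, degH (s - n - idx t) <= degD s + idx t) ->
  (forall z : int, z - n - idx t + 1 = 0 -> 0 <= degH z + idx t) ->
  all (fun c => deg c.2 <= deg g + deg (letter t)) (br g (letter t)).
Proof.
move=> hD hH; rewrite deg_letter; have t0 := idx_gt0 t.
rewrite /letter; case: (odd t); case: g => [s|z||] //; rewrite /br /= ?andbT.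
- by rewrite addrA.
- by case: eqP => //= e; rewrite andbT; apply: hH; lia.
- by apply/andP; split; [rewrite /degD; lia|case: eqP => //= e; rewrite /degD; lia].
- by rewrite /degH; lia.
Qed.
End Degrees.

(** * Lowering elements in case (1) *)

Section LoweringInjectiveD.
Variables (C : numFieldType) (k : nat) (n : int) (l : nat).
Local Notation br := (br C).
Hypotheses (k_gt0 : (0 < k)%N) (nk : n = k%:Z) (nl : 2 * n <= l%:Z).
Local Notation deg := (deg k n l).
Local Notation letter := (letter n).

Definition lower1 (t : nat) : gen :=
  if odd t then Hg (n + idx t - 1) else Dg (l%:Z + idx t).
Definition pivot1 (t : nat) : gen := if odd t then C2g else Dg l%:Z.
Definition coef1 (t : nat) : C :=
  if odd t then half_int C (n + idx t - 1) else (l%:Z + idx t - - idx t)%:~R.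

Let kn : 2 <= k%:Z + n. Proof. lia. Qed.
Let l_gt0 : (0 < l)%N. Proof. lia. Qed.

Lemma deg_br1 g t : all (fun c => deg c.2 <= deg g + deg (letter t)) (br g (letter t)).
Proof.
have t0 := idx_gt0 t.
by apply: deg_br_letter => // x; rewrite /degD /degH; lia.
Qed.

Lemma deg_lower1 t : deg (lower1 t) = - deg (letter t).
Proof.
rewrite deg_letter //; have := idx_gt0 t; rewrite /lower1.
by case: odd; rewrite /deg /degD /degH; lia.
Qed.

Lemma deg_pivot1 t : deg (pivot1 t) = 0.
Proof. by rewrite /pivot1; case: odd; rewrite /deg /degD; lia. Qed.

(** The delicate case is equal weight i: [d_{l+i}, h_{-n-i+1/2}] is a multiple of h_{l-n+1/2}, which
    kills V because l >= 2n. With h before d one would get h_{n-1/2}, which is injective on V. *)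
Lemma br_lower1 s t : (t < s)%N ->
  all (fun c => deg c.2 < deg (letter s) - deg (letter t)) (br (lower1 t) (letter s)).
Proof.
move=> /letter_ltP ts; rewrite !deg_letter //.
have := idx_gt0 s; have := idx_gt0 t => t0 s0.
rewrite /lower1 /letter.
case: ts => [[] []|] ts; rewrite /br; try (case: eqP => ? //); rewrite /= ?andbT /degD /degH; lia.
Qed.

Lemma br_lower1_diag t : br (lower1 t) (letter t) = [:: (coef1 t, pivot1 t)].
Proof.
have t0 := idx_gt0 t.
rewrite /lower1 /letter /coef1 /pivot1; case: odd; rewrite /br.
  by rewrite ifT //; apply/eqP; lia.
rewrite ifF; last by apply/eqP; lia.
by congr [:: (_, Dg _)]; lia.
Qed.

Lemma coef1_neq0 t : coef1 t != 0.
Proof.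
have t0 := idx_gt0 t; rewrite /coef1; case: odd; first exact: half_int_neq0.
by rewrite intr_eq0; lia.
Qed.

Lemma br_pivot1 s t :
  all (fun c => deg c.2 < deg (letter s)) (br (pivot1 t) (letter s)).
Proof.
rewrite deg_letter //; have s0 := idx_gt0 s; rewrite /pivot1 /letter.
case: (odd t) => //; case: (odd s); rewrite /br; try (case: eqP => ? //);
  rewrite /= ?andbT /degD /degH; lia.
Qed.

Lemma br_lower_pivot1 s t :
  all (fun c => deg c.2 < - deg (letter s)) (br (lower1 s) (pivot1 t)).
Proof.
rewrite deg_letter //; have s0 := idx_gt0 s; rewrite /pivot1 /lower1.
case: (odd t); case: (odd s) => //; rewrite /br; try (case: eqP => ? //);
  rewrite /= ?andbT /degD /degH; lia.
Qed.
End LoweringInjectiveD.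

(** * Lowering elements in case (2) *)

Section LoweringHeisenberg.
Variables (C : numFieldType) (k : nat) (n : int) (l : nat).
Local Notation br := (br C).
Hypotheses (nk : n < k%:Z) (kn : 2 <= k%:Z + n) (nl : l%:Z = n + k%:Z - 1).
Local Notation deg := (deg k n l).
Local Notation letter := (letter n).

Definition lower2 (t : nat) : gen :=
  if odd t then Dg (l%:Z + idx t) else Hg (k%:Z + idx t - 1).
Definition pivot2 (t : nat) : gen := Hg (k%:Z - 1).
Definition coef2 (t : nat) : C :=
  if odd t then - half_int C (- n - idx t) else half_int C (k%:Z + idx t - 1).

Let l_gt0 : (0 < l)%N. Proof. lia. Qed.

Lemma deg_br2 g t : all (fun c => deg c.2 <= deg g + deg (letter t)) (br g (letter t)).
Proof.
have t0 := idx_gt0 t.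
by apply: deg_br_letter => // x; rewrite /degD /degH; lia.
Qed.

Lemma deg_lower2 t : deg (lower2 t) = - deg (letter t).
Proof.
rewrite deg_letter //; have := idx_gt0 t; rewrite /lower2.
by case: odd; rewrite /deg /degD /degH; lia.
Qed.

Lemma deg_pivot2 t : deg (pivot2 t) = 0.
Proof. by rewrite /pivot2 /deg /degH; lia. Qed.

(** At equal weight, h_{k+i-1/2} commutes with h_{-n-i+1/2} because k > n. With h before d one would
    get a multiple of d_l, of degree 0. *)
Lemma br_lower2 s t : (t < s)%N ->
  all (fun c => deg c.2 < deg (letter s) - deg (letter t)) (br (lower2 t) (letter s)).
Proof.
move=> /letter_ltP ts; rewrite !deg_letter //.
have := idx_gt0 s; have := idx_gt0 t => t0 s0.
rewrite /lower2 /letter.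
case: ts => [[] []|] ts; rewrite /br; try (case: eqP => ? //); rewrite /= ?andbT /degD /degH; lia.
Qed.

Lemma br_lower2_diag t : br (lower2 t) (letter t) = [:: (coef2 t, pivot2 t)].
Proof.
have t0 := idx_gt0 t.
by rewrite /lower2 /letter /coef2 /pivot2; case: odd; rewrite /br;
  congr [:: (_, Hg _)]; lia.
Qed.

Lemma coef2_neq0 t : coef2 t != 0.
Proof. by rewrite /coef2; case: odd; rewrite ?oppr_eq0 half_int_neq0. Qed.

(** The bracket with d_{-i} is a multiple of h_{k-i-1/2}. If that is a letter, its weight is i -
    (k+n-1), less than i since k + n >= 2. *)
Lemma br_pivot2 s t :
  all (fun c => deg c.2 < deg (letter s)) (br (pivot2 t) (letter s)).
Proof.
rewrite deg_letter //; have s0 := idx_gt0 s; rewrite /pivot2 /letter.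
case: (odd s); rewrite /br; try (case: eqP => ? //);
  rewrite /= ?andbT /degD /degH; lia.
Qed.

Lemma br_lower_pivot2 s t :
  all (fun c => deg c.2 < - deg (letter s)) (br (lower2 s) (pivot2 t)).
Proof.
rewrite deg_letter //; have s0 := idx_gt0 s; rewrite /pivot2 /lower2.
case: (odd s) => //; rewrite /br; try (case: eqP => ? //);
  rewrite /= ?andbT /degD /degH; lia.
Qed.
End LoweringHeisenberg.

(** * Simplicity from lowering elements *)

Section Simplicity.
Variables (C : numFieldType) (k : nat) (n : int) (l : nat).
Variables (V : lmodType C) (AV : Dact V) (W : lmodType C) (AW : Dact W).
Variable iota : {linear V -> W}.
Local Notation deg := (deg k n l).
Local Notation letter := (letter n).
Hypotheses (kn : 2 <= k%:Z + n) (l_gt0 : (0 < l)%N).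
Hypothesis V_simple : is_simple Pd0 (Phn n) AV.
Hypothesis h_kill : forall i : int, k%:Z < i -> forall v, hh AV (i - 1) v = 0.
Hypothesis d_kill : forall j : int, l%:Z < j -> forall v, dd AV j v = 0.
Hypothesis W_ind : is_induced n AV AW iota.

(** A generator outside D^(0,-n) is a letter and raises the weight; one inside preserves the image
    of [iota], and is 0 there when its degree is negative. *)
Lemma act_iota_fil g v : fil AW iota deg letter (deg g) (act AW g (iota v)).
Proof.
have [_ [iota_hom _]] := W_ind.
have hom := iffLR (is_homP _ _ _ _ _) iota_hom.
have raise b i : 0 < i -> fil AW iota deg letter i
    (act AW (if b then Hg (- n - i) else Dg (- i)) (iota v)).
  move=> i0; have [r rb ri] := letter_index b i0.
  have -> : (if b then Hg (- n - i) else Dg (- i)) = letter r.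
    by rewrite /letter rb ri.
  by apply: fil_z; apply: fil_iota; rewrite deg_letter // ri subrr.
case: g => [s|z||].
- have [s0|s0] := ltP s 0.
    have := raise false (- s); rewrite opprK /deg.
    have -> : degD l s = - s by rewrite /degD; lia.
    by apply; lia.
  rewrite -hom //; have [sl|sl] := leP s l%:Z.
    by apply: fil_iota; rewrite /deg /degD; lia.
  by rewrite /act d_kill // linear0; apply: fil0.
- have [z0|z0] := ltP z (- n).
    have := raise true (- n - z); rewrite /deg.
    have -> : degH k n z = - n - z by rewrite /degH; lia.
    have -> : - n - (- n - z) = z by lia.
    by apply; lia.
  rewrite -hom //; have [zk|zk] := ltP z k%:Z.
    by apply: fil_iota; rewrite /deg /degH; lia.
  (* [hh z] is h_{z+1/2}, so [h_kill] applies with i = z + 1. *)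
  rewrite /act (_ : z = z + 1 - 1) ?h_kill ?linear0; first exact: fil0.
    by lia.
  by lia.
- by rewrite -hom //; apply: fil_iota.
- by rewrite -hom //; apply: fil_iota.
Qed.

Lemma simple_from_lowering (p al : nat -> gen) (cf : nat -> C) :
  (forall g t, all (fun c => deg c.2 <= deg g + deg (letter t)) (br C g (letter t))) ->
  (forall t, deg (p t) = - deg (letter t)) ->
  (forall t, deg (al t) = 0) ->
  (forall s t, (t < s)%N ->
    all (fun c => deg c.2 < deg (letter s) - deg (letter t)) (br C (p t) (letter s))) ->
  (forall t, br C (p t) (letter t) = [:: (cf t, al t)]) ->
  (forall t, cf t != 0) ->
  (forall s t, all (fun c => deg c.2 < deg (letter s)) (br C (al t) (letter s))) ->
  (forall s t, all (fun c => deg c.2 < - deg (letter s)) (br C (p s) (al t))) ->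
  (forall t, spans Pd0 (Phn n) (al t)) ->
  (forall t v, act AV (al t) v = 0 -> v = 0) ->
  is_simple predT predT AW.
Proof.
move=> deg_br deg_p deg_al br_pz br_pzE cf0 br_alz br_pal al_span al_inj.
have [W_rep [iota_hom _]] := W_ind.
have hom := iffLR (is_homP _ _ _ _ _) iota_hom.
have iota_inj := induced_injective W_ind V_simple.
have iota_eq0 v : iota v = 0 -> v = 0 by move=> e; apply: iota_inj; rewrite e linear0.
have wt_gt0 t : 0 < deg (letter t) by rewrite deg_letter.
have W_fil w : exists q, fil AW iota deg letter q w.
  (* The vectors of finite weight form a submodule containing the image of [iota]. *)
  apply: (induced_generated W_ind (S := fun w => exists q, fil AW iota deg letter q w))
    => [|v]; last by exists 0; apply: fil_iota.
  apply/is_submodP; split=> [|a u v [q fu] [r fv]|g v _ [q fv]].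
  - by exists 0; apply: fil0.
  - by exists (Num.max q r); apply: fil_lin; [apply: (fil_mono fu)|apply: (fil_mono fv)]; lia.
  - exists (q + deg g); exact: (fil_act W_rep act_iota_fil deg_br).
have [_ [[v0 v0_neq0] V_min]] := V_simple.
split=> //; split.
  by exists (iota v0); apply: contra_neq v0_neq0 => /iota_eq0.
move=> S S_sub; have [S_0|/existsNP[w /not_implyP[Sw /eqP w0]]] :=
  pselect (forall w, S w -> w = 0); first by left.
right; apply: (induced_generated W_ind S_sub).
have [S0 Slin Sact] := iffLR (is_submodP _ _ _ _) S_sub.
have [q fw] := W_fil w.
have [v v_neq0 Sv] : exists2 v, v != 0 & S (iota v).
  apply: (p_stable_meets_iota W_rep wt_gt0 _ act_iota_fil deg_br _ deg_p deg_al _ _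
    br_pz br_pzE cf0 br_alz br_pal) fw Sw w0.
  - exact: letter_unbounded.
  - exact: br_letters.
  - by move=> t u; exists (act AV (al t) u); rewrite hom.
  - by move=> t u; rewrite -hom // => /iota_eq0; apply: al_inj.
  - by move=> t u; apply: Sact; apply: full_span.
have [] := V_min (fun v => S (iota v)).
- apply/is_submodP; split=> [|a u u'|x u Px Su].
  + by rewrite linear0.
  + by rewrite linearP; apply: Slin.
  + by rewrite hom //; apply: Sact => //; apply: full_span.
- by move=> /(_ v Sv) /eqP; rewrite (negbTE v_neq0).
- by [].
Qed.
End Simplicity.
Local Open Scope complex_scope.

Theorem theorem3p1 (R : realType) (k : nat) (n : int) (l : nat) (ell : R[i])
    (V : lmodType R[i]) (AV : Dact V)
    (W : lmodType R[i]) (AW : Dact W) (iota : {linear V -> W}) :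
  (0 < k)%N -> n <= k%:Z ->
  is_simple Pd0 (Phn n) AV ->
  ell != 0 -> (forall v, cc2 AV v = ell *: v) ->
  injective (hh AV (k%:Z - 1)) ->
  (forall i : int, k%:Z < i -> forall v, hh AV (i - 1) v = 0) ->
  (forall j : int, l%:Z < j -> forall v, dd AV j v = 0) ->
  ((n = k%:Z /\ 2 * n <= l%:Z /\ injective (dd AV l%:Z)) \/
   (n < k%:Z /\ 2 <= k%:Z + n /\ l%:Z = n + k%:Z - 1)) ->
  is_induced n AV AW iota ->
  is_simple predT predT AW.
Proof.
move=> k0 nk V_simple ell0 level h_inj h_kill d_kill cases W_ind.
have inj0 (f : {linear V -> V}) v : injective f -> f v = 0 -> v = 0.
  by move=> f_inj fv0; apply: f_inj; rewrite fv0 linear0.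
case: cases => [[nk' [nl d_inj]]|[nk' [kn nl]]].
- apply: (simple_from_lowering (k := k) (l := l) _ _ V_simple h_kill d_kill W_ind
    (p := lower1 n l) (al := pivot1 l) (cf := coef1 R[i] n l)).
  + by lia.
  + by lia.
  + by move=> g t; apply: deg_br1.
  + by move=> t; apply: deg_lower1.
  + by move=> t; apply: deg_pivot1.
  + by move=> s t; apply: br_lower1.
  + by move=> t; apply: br_lower1_diag nk' nl _.
  + by move=> t; apply: coef1_neq0 nk' nl _.
  + by move=> s t; apply: br_pivot1.
  + by move=> s t; apply: br_lower_pivot1.
  + by move=> t; rewrite /pivot1; case: odd.
  + move=> t v; rewrite /pivot1; case: odd; last exact: inj0.
    by rewrite /act level => /eqP; rewrite scaler_eq0 (negbTE ell0) => /eqP.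
- apply: (simple_from_lowering (k := k) (l := l) _ _ V_simple h_kill d_kill W_ind
    (p := lower2 k l) (al := pivot2 k) (cf := coef2 R[i] k n)).
  + by lia.
  + by lia.
  + by move=> g t; apply: deg_br2.
  + by move=> t; apply: deg_lower2.
  + by move=> t; apply: deg_pivot2.
  + by move=> s t; apply: br_lower2.
  + by move=> t; apply: br_lower2_diag.
  + by move=> t; apply: coef2_neq0.
  + by move=> s t; apply: br_pivot2.
  + by move=> s t; apply: br_lower_pivot2.
  + by move=> t; rewrite /pivot2 /spans /Phn; lia.
  + by move=> t v; apply: inj0.
Qed.
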